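(* Let $p$ be an odd prime and let $\alpha$ be an indeterminate over $\mathbb F_p$. There is a unique polynomial $G^{(\alpha)}(X)\in\mathbb F_p(\alpha)[X]$ of degree less than $p$ such that \[ G^{(\alpha)}\bigl(L_{p-1}^{(\alpha)}(X)\bigr)\equiv X \pmod{X^p-(\alpha^p-\alpha)} \] in $\mathbb F_p(\alpha)[X]$, and it is given by \[ G^{(\alpha)}(X)=-\sum_{k=1}^{p-1}\frac{1}{k}\,\frac{X^{k}}{\prod_{s=1}^{k-1}b_{1,s}(\alpha)}, \] where the empty product (for $k=1$) equals $1$.
   Context: $p$ is an odd prime and $\mathbb F_p$ the field of $p$ elements. The (generalized Laguerre) polynomial $L_{p-1}^{(\alpha)}(X)\in\mathbb F_p[\alpha,X]$ is defined by $L_{p-1}^{(\alpha)}(X)=\sum_{k=0}^{p-1}\binom{\alpha-1}{p-1-k}\frac{(-X)^k}{k!}$, where $\binom{x}{m}=x(x-1)\cdots(x-m+1)/m!$. For integers $0<r,s<p$ (integers are freely interpreted as elements of $\mathbb F_p$), the polynomial $b_{r,s}(\alpha)\in\mathbb F_p[\alpha]$ is defined by $b_{r,s}(\alpha)=\sum_{k=0}^{p-1}(-r/s)^k\binom{r\alpha-1}{p-1-k}\binom{s\alpha-1}{k}$. *)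

(* Defs.v *)
From HB Require Import structures.
From mathcomp Require Import all_boot all_order all_algebra fraction.
Set Implicit Arguments.
Unset Strict Implicit.
Unset Printing Implicit Defensive.
Import GRing.Theory.
Local Open Scope ring_scope.

Notation Fpa p := {fraction {poly 'F_p}}.

Definition alpha (p : nat) : Fpa p := FracField.tofrac ('X : {poly 'F_p}).

Definition binomf (K : fieldType) (x : K) (m : nat) : K :=
  (\prod_(i < m) (x - i%:R)) / (m`!)%:R.

Definition laguerre (p : nat) : {poly Fpa p} :=
  \sum_(k < p) (binomf (alpha p - 1) (p.-1 - k) / (k`!)%:R) *: (- 'X) ^+ k.

Definition bcoef (p r s : nat) : Fpa p :=
  \sum_(k < p) (- (r%:R) / (s%:R)) ^+ k
     * binomf (r%:R * alpha p - 1) (p.-1 - k) * binomf (s%:R * alpha p - 1) k.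

Definition Gpoly (p : nat) : {poly Fpa p} :=
  - \sum_(1 <= k < p) ((k%:R)^-1 / \prod_(1 <= s < k) bcoef p 1 s) *: 'X^k.

Definition modulus (p : nat) : {poly Fpa p} :=
  'X^p - (alpha p ^+ p - alpha p)%:P.

(* Main.v *)
(* Modulo X^p - (a^p - a), the polynomial Q_n = L_{p-1}^{(n a)}(n X) solves the
   first-order equation X y' = n (X - a) y, whose solutions form a line when
   0 < n < p.  As Q_1 Q_s solves the equation for n = s + 1, it is congruent to a
   multiple of Q_{s+1}; comparing coefficients of X^(p-1) identifies the factor
   as b_{1,s}(a).  Hence L^k is congruent to (b_{1,1} ... b_{1,k-1}) Q_k, and the
   formula for G reduces to X = - sum_{0<k<p} Q_k / k, which holds because the
   sums sum_{k in F_p} k^i vanish for i < p - 1.  For uniqueness, X d/dX acts on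
   L^n as multiplication by n (X - a), whence L^0, ..., L^(p-1) are linearly
   independent by the usual argument for distinct eigenvalues.
   Finally, b_{1,s} is nonzero because
   it takes the value sum_k (-1/s)^k = 1 at a = 0. *)

Require Import Defs.
From HB Require Import structures.
From mathcomp Require Import all_boot all_order all_algebra fraction.
From mathcomp Require Import zify ring.
Import GRing.Theory.
Local Open Scope ring_scope.

(** * Arithmetic in characteristic p *)

Section PrimeCharacteristic.
Variables (F : fieldType) (p : nat).
Hypotheses (p_prime : prime p) (p_odd : odd p) (charFp : p \in [pchar F]).


Lemma natr_neq0 n : (0 < n < p)%N -> n%:R != 0 :> F.
Proof.
move=> /andP[n0 np]; rewrite -(dvdn_pcharf charFp).
by apply/negP=> /(dvdn_leq n0); rewrite leqNgt np.
Qed.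

Lemma natr_expp n : n%:R ^+ p = n%:R :> F.
Proof. by rewrite -(pFrobenius_autE charFp) pFrobenius_aut_nat. Qed.

Lemma natr_expp1 n : (0 < n < p)%N -> n%:R ^+ p.-1 = 1 :> F.
Proof.
move=> /natr_neq0 n0; apply: (mulfI n0).
by rewrite -exprS prednK ?prime_gt0 // natr_expp mulr1.
Qed.

Lemma natr_inj m n : (m < p)%N -> (n < p)%N -> (m%:R == n%:R :> F) = (m == n).
Proof.
wlog le_mn: m n / (m <= n)%N => [H mp np|mp np].
  case: (leqP m n) => [|/ltnW] le; first exact: H.
  by rewrite eq_sym H // eq_sym.
rewrite eq_sym -subr_eq0 -natrB // [RHS]eq_sym.
case: (ltngtP m n) le_mn => // [lt_mn _|-> _]; last by rewrite subnn eqxx.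
by apply/negbTE/natr_neq0; lia.
Qed.

Lemma natr_fact_neq0 m : (m < p)%N -> (m`!)%:R != 0 :> F.
Proof.
elim: m => [|m IH] mp; first by rewrite fact0 oner_eq0.
by rewrite factS natrM mulf_neq0 ?IH ?(ltnW mp) //; apply: natr_neq0.
Qed.

Lemma natr_factp1 : ((p.-1)`!)%:R = -1 :> F.
Proof.
apply/eqP; rewrite -addr_eq0 natr1 -(dvdn_pcharf charFp) -Wilson //.
exact: prime_gt1.
Qed.

Lemma binomf0 (x : F) : binomf x 0 = 1.
Proof. by rewrite /binomf big_ord0 fact0 divr1. Qed.

Lemma binomfS (x : F) m : (m.+1 < p)%N ->
  binomf x m.+1 * m.+1%:R = binomf x m * (x - m%:R).
Proof.
move=> mp; rewrite /binomf big_ord_recr /= factS natrM.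
have := natr_fact_neq0 m (ltnW mp); have : m.+1%:R != 0 :> F by apply: natr_neq0.
move: (m.+1%:R) => y y0 m0; field; exact/andP.
Qed.

Lemma binomfN1 m : (m < p)%N -> binomf (-1 : F) m = (-1) ^+ m.
Proof.
elim: m => [|m IH] mp; first by rewrite binomf0.
have m0 : m.+1%:R != 0 :> F by apply: natr_neq0.
apply: (mulIf m0); rewrite binomfS // IH ?(ltnW mp) // -natr1 exprS; ring.
Qed.

(** The p residues are distinct roots of the monic polynomial X^p - X of degree p, which therefore
    splits; evaluate at [x]. *)
Lemma prod_sub_natr (x : F) : \prod_(i < p) (x - i%:R) = x ^+ p - x.
Proof.
have sz : size ('X^p - 'X : {poly F}) = p.+1.
  by rewrite size_polyDl size_polyXn // size_polyN size_polyX ltnS prime_gt1.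
have E : 'X^p - 'X =
    lead_coef ('X^p - 'X : {poly F})
      *: \prod_(z <- [seq i%:R | i <- iota 0 p]) ('X - z%:P).
  apply: all_roots_prod_XsubC; first by rewrite sz size_map size_iota.
    apply/allP=> _ /mapP[i _ ->].
    by rewrite rootE !hornerE natr_expp subrr.
  rewrite uniq_rootsE map_inj_in_uniq ?iota_uniq // => i j.
  rewrite !mem_iota /= !add0n => ip jp /eqP.
  by rewrite natr_inj // => /eqP.
have lc : lead_coef ('X^p - 'X : {poly F}) = 1.
  by rewrite lead_coefE sz /= coefB coefXn coefX eqxx gtn_eqF ?prime_gt1 ?subr0.
move/(congr1 (horner^~ x)): E; rewrite lc scale1r !hornerE => ->.
rewrite horner_prod big_map -[p in iota _ p]subn0 -/(index_iota 0 p) big_mkord.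
by apply: eq_bigr => i _; rewrite !hornerE.
Qed.

Lemma mul_binomf_pred (x : F) : x * binomf (x - 1) p.-1 = x - x ^+ p.
Proof.
have E q : (0 < q)%N ->
    \prod_(i < q) (x - i%:R) = x * \prod_(i < q.-1) (x - 1 - i%:R).
  case: q => // q _; rewrite big_ord_recl subr0; congr (_ * _).
  by apply: eq_bigr => i _; rewrite lift0 -natr1; ring.
rewrite -[RHS]opprB -prod_sub_natr E ?prime_gt0 // /binomf natr_factp1 invrN1.
by rewrite mulrN1 mulrN.
Qed.

(** The differences (k+1)^(i+1) - k^(i+1) telescope to 0 over a full period. Their binomial
    expansion leaves i+1 times the wanted sum, as the lower power sums vanish by induction. *)
Lemma sum_natr_exp i : (i < p.-1)%N -> \sum_(k < p) k%:R ^+ i = 0 :> F.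
Proof.
elim/ltn_ind: i => i IH ip.
have : \sum_(0 <= k < p) (k.+1%:R ^+ i.+1 - k%:R ^+ i.+1) = 0 :> F.
  by rewrite telescope_sumr // (pcharf0 charFp) !expr0n /= subrr.
rewrite big_mkord; under eq_bigr => k _ do
  rewrite -natr1 exprD1n big_ord_recr /= binn mulr1n addrK.
rewrite exchange_big big_ord_recr /= big1 ?add0r => [|j _]; last first.
  by rewrite sumrMnl IH ?mul0rn //; apply: ltn_trans ip.
rewrite sumrMnl binSn -mulr_natr => /eqP; rewrite mulf_eq0.
by rewrite (negbTE (natr_neq0 i.+1 _)) ?orbF; [move/eqP | lia].
Qed.

Lemma sum_natr_horner (f : {poly F}) :
  (size f <= p.-1)%N -> \sum_(k < p) f.[k%:R] = 0.
Proof.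
move=> sf; under eq_bigr => k _ do rewrite horner_coef.
rewrite exchange_big big1 // => i _.
by rewrite -mulr_sumr sum_natr_exp ?mulr0 //; apply: leq_trans sf.
Qed.

Variable a : F.

(** Binomial coefficients as polynomials, so that sums over residues vanish by a degree bound. *)
Definition binomp m : {poly F} :=
  ((m`!)%:R)^-1 *: \prod_(i < m) (a *: 'X - (1 + i%:R)%:P).

Lemma binompE m x : (binomp m).[x] = binomf (x * a - 1) m.
Proof.
rewrite /binomp /binomf hornerZ horner_prod mulrC; congr (_ / _).
by apply: eq_bigr => i _; rewrite !hornerE; ring.
Qed.

Lemma size_binomp m : (size (binomp m) <= m.+1)%N.
Proof.
rewrite (leq_trans (size_scale_leq _ _)) //.
elim: m => [|m IH]; first by rewrite big_ord0 size_poly1.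
rewrite big_ord_recr /= (leq_trans (size_polyMleq _ _)) //.
set q := _ - _; have sq : (size q <= 2)%N; last first.
  by rewrite -subn1 leq_subLR (leq_trans (leq_add IH sq)) // addn2.
rewrite (leq_trans (size_polyD _ _)) // geq_max size_polyN.
rewrite (leq_trans (size_scale_leq _ _)) ?size_polyX //=.
by rewrite (leq_trans (size_polyC_leq1 _)).
Qed.

(** * Laguerre polynomials and their differential equation *)

(* [lag n] is the paper's L_{p-1}^{(n a)}(n X). *)
Definition lagc n j : F :=
  binomf (n%:R * a - 1) (p.-1 - j) / (j`!)%:R * (- n%:R) ^+ j.
Definition lag n : {poly F} := \poly_(j < p) lagc n j.
Definition modp_a : {poly F} := 'X^p - (a ^+ p - a)%:P.

Lemma sum_lag : a != 0 -> - \sum_(1 <= k < p) k%:R^-1 *: lag k = 'X.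
Proof.
move=> a0; have p2 : (2 < p)%N by apply: odd_prime_gt2.
apply/polyP => j; rewrite coefN coef_sum coefX.
under eq_bigr => k _ do rewrite coefZ coef_poly.
case: (ltnP j p) => jp; last first.
  rewrite big1 => [|k _]; last by rewrite mulr0.
  by rewrite oppr0; case: eqP jp => // ->; lia.
case: j jp => [|j] jp.
  (* The constant coefficients, scaled by the nonzero [a], are proportional to k^(p-2). That power
     sum over all residues vanishes, and its term k = 0 is zero because p > 2. *)
  apply/eqP; rewrite oppr_eq0 -(mulrI_eq0 _ (mulfI a0)); apply/eqP.
  have Ek k : (1 <= k < p)%N ->
      a * (k%:R^-1 * lagc k 0) = (a - a ^+ p) * k%:R ^+ p.-2.
    move=> kp; have k0 := natr_neq0 k kp.
    have H := mul_binomf_pred (k%:R * a).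
    rewrite exprMn natr_expp -mulrA -mulrBr in H.
    rewrite /lagc subn0 fact0 divr1 expr0 mulr1 mulrCA (mulfI k0 H) mulrC.
    congr (_ * _); apply: (mulfI k0); rewrite divff // -exprS.
    by rewrite prednK ?natr_expp1 //; lia.
  rewrite mulr_sumr (eq_big_nat _ _ Ek) -mulr_sumr.
  have /esym := sum_natr_exp p.-2 ltac:(lia).
  rewrite -(big_mkord predT (fun k => k%:R ^+ p.-2)) (big_ltn (prime_gt0 p_prime)).
  by rewrite expr0n (_ : (p.-2 == 0)%N = false) ?add0r => [<-|]; [ring|lia].
(* In positive degree, [f] carries the dependence on k. Its degree is at most p-2, so its sum over
   nonzero k is minus its value at 0. *)
pose f := 'X^j * binomp (p.-1 - j.+1).
have Ek k : (1 <= k < p)%N ->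
    k%:R^-1 * lagc k j.+1 = (-1) ^+ j.+1 / (j.+1`!)%:R * f.[k%:R].
  move=> /natr_neq0 k0.
  rewrite /f hornerM hornerXn binompE /lagc exprNn [k%:R ^+ _]exprS.
  by have := natr_fact_neq0 _ jp; move: (_`!) => y y0; field; apply/andP.
have sf : (size f <= p.-1)%N.
  rewrite (leq_trans (size_polyMleq _ _)) // size_polyXn.
  by have := size_binomp (p.-1 - j.+1); lia.
have /esym := sum_natr_horner f sf.
rewrite -(big_mkord predT (fun k => f.[k%:R])) (big_ltn (prime_gt0 p_prime)) => S.
rewrite (eq_big_nat _ _ Ek) -mulr_sumr.
have -> : \sum_(1 <= k < p) f.[k%:R] = - f.[0%:R].
  by apply/eqP; rewrite -addr_eq0 addrC -S.
(* The factor X^j kills the value at 0 unless j = 0, which is the coefficient of X; there the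
   oddness of p-2 fixes the sign. *)
rewrite /f hornerM hornerXn binompE mul0r sub0r binomfN1; last by lia.
rewrite expr0n; case: j {jp f Ek sf S} => [|j] /=; last by rewrite mul0r; ring.
have o : odd (p.-1 - 1) by lia.
by rewrite -(signr_odd _ (p.-1 - 1)) o expr1 divr1; ring.
Qed.

Lemma lagcS n j : (j.+1 < p)%N ->
  n%:R * lagc n j = (n%:R * a + j.+1%:R) * lagc n j.+1.
Proof.
move=> jp; rewrite /lagc; set m := (p.-1 - j.+1)%N.
have -> : (p.-1 - j)%N = m.+1 by rewrite /m; lia.
(* Since p-1-j equals -(j+1) in [F], the recursion of [binomfS] acquires the factor n a + (j+1). *)
have mE : m.+1%:R = - j.+1%:R :> F.
  apply/eqP; rewrite -addr_eq0 -natrD (_ : (m.+1 + j.+1)%N = p) ?(pcharf0 charFp) //.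
  by rewrite /m; lia.
have := binomfS (n%:R * a - 1) m; rewrite mE -[m%:R](addrK 1) natr1 mE.
move=> /(_ _)/wrap[]; first by rewrite /m; lia.
have := natr_neq0 j.+1 jp; have := natr_fact_neq0 j (ltnW jp).
rewrite factS natrM exprS; move: (_`!%:R) (j.+1%:R) => u v u0 v0 H.
have -> : binomf (n%:R * a - 1) m.+1 =
    - (binomf (n%:R * a - 1) m * (n%:R * a + v) / v).
  have v1 : - v != 0 by rewrite oppr_eq0.
  by apply: (mulIf v1); rewrite H; field.
by field; apply/andP.
Qed.

Lemma lagc_last n : (0 < n < p)%N -> lagc n p.-1 = -1.
Proof.
move=> np; rewrite /lagc subnn binomf0 natr_factp1 exprNn natr_expp1 //.
have e : odd p.-1 = false by have := prime_gt1 p_prime; lia.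
by rewrite -signr_odd e expr0 invrN1; ring.
Qed.

Lemma size_lag n : (size (lag n) <= p)%N.
Proof. exact: size_poly. Qed.

Lemma size_modp_a : size modp_a = p.+1.
Proof.
rewrite /modp_a size_polyDl size_polyXn // size_polyN.
by rewrite (leq_ltn_trans (size_polyC_leq1 _)) // ltnS prime_gt0.
Qed.

Lemma modp_a_dvd_small (q : {poly F}) : (size q <= p)%N -> modp_a %| q -> q = 0.
Proof.
move=> sq dq; apply/eqP/negPn/negP=> /dvdp_leq /(_ dq).
by rewrite size_modp_a ltnNge sq.
Qed.

Lemma deriv_modp_a : modp_a^`() = 0.
Proof.
by rewrite /modp_a derivB derivXn derivC subr0 -mulr_natr
  -polyC_natr (pcharf0 charFp) mulr0.
Qed.

(** In degrees 1 to p-1 the equation is the recursion [lagcS]. The defects in degree 0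
    ([mul_binomf_pred]) and degree p ([lagc_last]) are exactly those repaired by [modp_a]. *)
Lemma lag_ode n : (n < p)%N ->
  'X * (lag n)^`() = n%:R *: (('X - a%:P) * lag n + modp_a).
Proof.
move=> np; have p0 := prime_gt0 p_prime; have p1 := prime_gt1 p_prime.
apply/polyP => -[|j].
  rewrite coefXM coefZ coefD mulrBl coefB coefXM coefCM /= [(lag n)`_0]coef_poly p0.
  rewrite /modp_a coefB coefXn coefC eqxx /= eq_sym gtn_eqF //.
  rewrite /lagc subn0 fact0 divr1 expr0 mulr1.
  have := mul_binomf_pred (n%:R * a); rewrite exprMn natr_expp -mulrA => H.
  by rewrite !sub0r mulrDr mulrN H; ring.
rewrite coefXM coefZ coefD mulrBl coefB coefXM coefCM coef_deriv /=.
rewrite /modp_a coefB coefXn coefC /= subr0 /lag !coef_poly.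
case: (ltngtP j.+1 p) => jp.
- rewrite addr0 mulrBr lagcS // -[LHS]mulr_natr; ring.
- by rewrite mul0rn !(mulr0, subr0, addr0).
have -> : j = p.-1 by lia.
case: (posnP n) => [->|n0]; first by rewrite mul0r mul0rn.
by rewrite lagc_last ?n0 // mulr0 subr0 addNr mulr0 mul0rn.
Qed.

Definition ode n (R : {poly F}) := 'X * R^`() - n%:R *: (('X - a%:P) * R).

(** As [modp_a] has zero derivative, the differential operator descends to the quotient by
    [modp_a]. *)
Lemma odeM_modp_a n R : modp_a %| ode n (R * modp_a).
Proof.
rewrite /ode derivM deriv_modp_a mulr0 addr0 mulrA [_ * (R * _)]mulrA.
by apply: dvdp_sub; rewrite ?scalerAl dvdp_mull.
Qed.

Lemma odeD n R S : ode n (R + S) = ode n R + ode n S.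
Proof. by rewrite /ode derivD !mulrDr scalerDr opprD addrACA. Qed.

Lemma odeZ n c R : ode n (c *: R) = c *: ode n R.
Proof. by rewrite /ode derivZ -!scalerAr scalerBr !scalerA [n%:R * c]mulrC. Qed.

Lemma ode_lag n : (n < p)%N -> ode n (lag n) = n%:R *: modp_a.
Proof. by move=> np; rewrite /ode lag_ode // scalerDr addrC addKr. Qed.

(** By the product rule, logarithmic derivatives add under multiplication. *)
Lemma ode_lagM m n : (m < p)%N -> (n < p)%N ->
  modp_a %| ode (m + n) (lag m * lag n).
Proof.
move=> mp np; rewrite /ode derivM mulrDr !mulrA lag_ode //.
rewrite [_ * lag m]mulrC -!mulrA lag_ode // natrD scalerDl.
set L := lag m; set N := lag n; set A := 'X - _.
rewrite (_ : _ - _ = (m%:R *: N + n%:R *: L) * modp_a) ?dvdp_mull //.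
rewrite -!mul_polyC; ring.
Qed.

(* Comparing top coefficients shows that the equation, taken modulo X^p - c,
   determines all coefficients from the one of X^(p-1). *)
Lemma ode_unique n (R : {poly F}) : (0 < n < p)%N -> (size R <= p)%N -> R`_p.-1 = 0 ->
  modp_a %| ode n R -> R = 0.
Proof.
move=> np sR R0 dR; have p0 := prime_gt0 p_prime.
(* The vanishing coefficient of X^(p-1) keeps the degree of [ode n R] below p, so the congruence
   becomes an equality. *)
have D0 : ode n R = 0.
  apply: modp_a_dvd_small dR; apply/leq_sizeP => -[|j] pj; first lia.
  rewrite /ode mulrBl coefB coefXM coefZ coefB coefXM coefCM coef_deriv /=.
  have -> : R`_j.+1 = 0 by apply/(leq_sizeP _ _ sR).
  have -> : R`_j = 0.
    case: (ltngtP p j.+1) pj => // pj' _; last by have -> : j = p.-1 by lia.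
    exact/(leq_sizeP _ _ sR).
  by rewrite mul0rn !(mulr0, subr0).
apply/eqP/negPn/negP => R1.
have /(congr1 (fun q : {poly F} => q`_(size R))) := D0.
rewrite coef0 /ode mulrBl coefB coefXM coefZ coefB coefXM coefCM coef_deriv.
rewrite size_poly_eq0 (negbTE R1) prednK ?lt0n ?size_poly_eq0 //.
rewrite (nth_default 0 (leqnn (size R))) mul0rn mulr0 subr0 sub0r => /eqP.
by rewrite oppr_eq0 mulf_eq0 (negbTE (natr_neq0 n np)) /= -lead_coefE
  lead_coef_eq0 (negbTE R1).
Qed.

(* [bcoef p 1 s] with an arbitrary field element [a] in place of alpha. *)
Definition bco s : F :=
  \sum_(k < p) (- (1%:R) / (s%:R)) ^+ k
     * binomf (1%:R * a - 1) (p.-1 - k) * binomf (s%:R * a - 1) k.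

(** Wilson's theorem is the case i = 0; each step trades the factor p-1-i for i+1, its negative in
    [F]. *)
Lemma natr_factM i : (i < p)%N ->
  (i`!)%:R * ((p.-1 - i)`!)%:R = (-1) ^+ i.+1 :> F.
Proof.
elim: i => [|i IH] ip; first by rewrite subn0 fact0 mul1r natr_factp1 expr1.
rewrite exprS -IH ?(ltnW ip) // (_ : (p.-1 - i)%N = (p.-1 - i.+1).+1); last by lia.
rewrite !factS !natrM; set m := (p.-1 - i.+1)%N.
have -> : m.+1%:R = - i.+1%:R :> F; last by ring.
apply/eqP; rewrite -addr_eq0 -natrD (_ : (m.+1 + i.+1)%N = p) ?(pcharf0 charFp) //.
by rewrite /m; lia.
Qed.

(** The left side is the coefficient of X^(p-1) in [lag 1 * lag s]. The terms match by [natr_factM],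
    the evenness of p-1, and s^(p-1-i) = s^(-i). *)
Lemma lagcM_bco s : (0 < s < p)%N ->
  \sum_(i < p) lagc 1 i * lagc s (p.-1 - i) = - bco s.
Proof.
move=> sp; rewrite /bco -sumrN; apply: eq_bigr => -[i ip] _ /=.
have s0 := natr_neq0 s sp.
rewrite /lagc subKn; last by lia.
have := natr_factM i ip; have := natr_fact_neq0 i ip.
have : ((p.-1 - i)`!)%:R != 0 :> F by apply: natr_fact_neq0; lia.
have e : (-1) ^+ (p.-1 - i) = (-1) ^+ i :> F.
  rewrite -(signr_odd _ (p.-1 - i)) -(signr_odd _ i); congr (_ ^+ _).
  by congr nat_of_bool; lia.
have se : s%:R ^+ (p.-1 - i) = (s%:R ^+ i)^-1 :> F.
  apply: (mulIf (expf_neq0 i s0)); rewrite mulVf ?expf_neq0 // -exprD subnK; last by lia.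
  exact: natr_expp1.
rewrite [(- s%:R) ^+ _]exprNn e se expr_div_n exprS.
have : (-1) ^+ i * (-1) ^+ i = 1 :> F by rewrite -expr2 sqrr_sign.
have := expf_neq0 i s0.
move: (s%:R ^+ i) ((-1) ^+ i) (binomf _ _) (binomf _ _) (_`!%:R) (_`!%:R).
move=> w t A B v u w0 tt u0 v0 uv.
have t0 : t != 0 by apply: contra_eq_neq tt => ->; rewrite mul0r eq_sym oner_eq0.
have -> : v = - t / u by rewrite -[v](mulfK u0) uv; ring.
transitivity (- (A * B * (t * t) / (w * t))); first by field; rewrite ?oppr_eq0 ?t0 ?u0 ?w0.
have -> : w * t = w / t by rewrite -[w in RHS]mulr1 -tt; field.
by rewrite tt; field; rewrite ?oppr_eq0 ?t0 ?u0 ?w0.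
Qed.

Lemma lag_mul s : (0 < s)%N -> (s.+1 < p)%N ->
  modp_a %| lag 1 * lag s - bco s *: lag s.+1.
Proof.
move=> s0 sp; have p1 := prime_gt1 p_prime.
set N := _ - _; pose c := a ^+ p - a.
(* The remainder of [N] modulo [modp_a], obtained by replacing X^p with [c]. *)
pose R := take_poly p N + c *: drop_poly p N.
have NR : N = R + drop_poly p N * modp_a.
  by rewrite -[LHS](poly_take_drop p) /R /modp_a -mul_polyC -/c; ring.
have sNp : (size (lag 1 * lag s)%R <= p.*2.-1)%N.
  rewrite (leq_trans (size_polyMleq _ _)) // -addnn.
  by rewrite -!subn1 leq_sub2r // leq_add ?size_lag.
have sN : (size N <= p.*2.-1)%N.
  rewrite (leq_trans (size_polyD _ _)) // geq_max sNp size_polyN.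
  by rewrite (leq_trans (size_scale_leq _ _)) // (leq_trans (size_lag _)) //; lia.
have dN : modp_a %| ode s.+1 N.
  rewrite /N odeD -scaleNr odeZ ode_lag //; apply: dvdp_add.
    by rewrite -add1n ode_lagM // ltnW.
  by rewrite scalerA -mul_polyC dvdp_mull.
rewrite NR (_ : R = 0) ?add0r ?dvdp_mull //.
apply: (ode_unique s.+1) => //.
- rewrite (leq_trans (size_polyD _ _)) // geq_max size_take_poly.
  rewrite (leq_trans (size_scale_leq _ _)) // size_drop_poly.
  by rewrite leq_subLR (leq_trans sN) //; lia.
(* Reduction leaves the coefficient of X^(p-1) unchanged, as [N] has no term of degree 2p-1; it is
   zero by the choice of [bco s]. *)
- rewrite /R coefD coefZ coef_take_poly coef_drop_poly.
  rewrite (_ : (p.-1 < p)%N); last by lia.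
  rewrite [N`_(_ + p)]nth_default ?mulr0 ?addr0; last by rewrite (leq_trans sN) //; lia.
  rewrite /N coefB coefZ coef_poly (_ : (p.-1 < p)%N); last by lia.
  rewrite lagc_last; last by lia.
  rewrite coefM prednK ?prime_gt0 // -[bco s]opprK -lagcM_bco; last by lia.
  rewrite mulrN1 opprK; apply/eqP; rewrite subr_eq0; apply/eqP.
  by apply: eq_bigr => i _; rewrite !coef_poly ltn_ord (_ : (_ < p)%N) //; lia.
- by move: dN; rewrite {1}NR odeD dvdp_addl // odeM_modp_a.
Qed.

Lemma lag_exp k : (0 < k < p)%N ->
  modp_a %| lag 1 ^+ k - (\prod_(1 <= s < k) bco s) *: lag k.
Proof.
elim: k => // -[_ _|k IH /andP[_ kp]].
  by rewrite big_geq // scale1r subrr dvdp0.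
rewrite big_nat_recr //= -scalerA exprS.
have := lag_mul k.+1 isT kp; have := IH (ltnW kp).
set B := \prod_(1 <= s < _) _ => /(dvdp_mull (lag 1)) d1 /(dvdp_mull B%:P) d2.
rewrite (_ : _ - _ = lag 1 * (lag 1 ^+ k.+1 - B *: lag k.+1)
  + B%:P * (lag 1 * lag k.+1 - bco k.+1 *: lag k.+2)) ?dvdp_add //.
by rewrite -!mul_polyC; ring.
Qed.

(** * Injectivity of composition with L *)

Hypothesis a_neq0 : a != 0.

(** Differentiation preserves divisibility by [modp_a], and the chain rule with [lag_ode] produces
    the extra factor X - a. This factor is coprime to [modp_a], whose value at [a] is [a], hence
    nonzero. *)
Lemma dvd_comp_lagXderiv (H : {poly F}) :
  modp_a %| H \Po lag 1 -> modp_a %| ('X * H^`()) \Po lag 1.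
Proof.
have p1 := prime_gt1 p_prime; have p0 := prime_gt0 p_prime.
move=> /dvdpP[q Hq].
have d1 : modp_a %| 'X * (H \Po lag 1)^`().
  by rewrite Hq derivM deriv_modp_a mulr0 addr0 mulrA dvdp_mull.
move: d1; rewrite deriv_comp mulrCA lag_ode // scale1r mulrDr.
rewrite (dvdp_addl _ (dvdp_mull _ (dvdpp _))) mulrCA Gauss_dvdpr.
  by rewrite comp_polyM comp_polyX mulrC.
rewrite coprimep_XsubC rootE /modp_a !hornerE.
by rewrite opprB addrC subrK.
Qed.

Hypothesis bco_neq0 : forall s, (1 <= s < p.-1)%N -> bco s != 0.

Lemma prod_bco_neq0 k : (k < p)%N -> \prod_(1 <= s < k) bco s != 0.
Proof.
move=> kp; rewrite prodf_seq_neq0; apply/allP => s; rewrite mem_index_iota => sk.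
by apply: bco_neq0; lia.
Qed.

Lemma lag_neq0 n : (0 < n < p)%N -> lag n != 0.
Proof.
move=> np; apply/eqP => /(congr1 (fun q : {poly F} => q`_p.-1)) /eqP.
rewrite coef_poly coef0 (_ : (p.-1 < p)%N); last by lia.
by rewrite lagc_last // oppr_eq0 oner_eq0.
Qed.

(* X d/dX acts on L^n as multiplication by n (X - a), so that applying
   H |-> X H' - n H lowers the degree of a relation H(L) = 0. *)
Lemma comp_lag_inj (H : {poly F}) : (size H <= p)%N -> modp_a %| H \Po lag 1 -> H = 0.
Proof.
have p1 := prime_gt1 p_prime.
suff {H} IH n (H : {poly F}) : (n <= p)%N -> (size H <= n)%N -> modp_a %| H \Po lag 1 -> H = 0.
  exact: IH.
elim: n H => [|n IH] H np sH dH.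
  by apply/eqP; rewrite -size_poly_eq0 -leqn0.
have H2 : 'X * H^`() - n%:R *: H = 0.
  apply: IH; first exact: ltnW.
    apply/leq_sizeP => j nj; rewrite coefB coefZ coefXM coef_deriv.
    case: (ltngtP n j) nj => // [nj|<-] _; last first.
      case: (n) => [|m] /=; first by rewrite mul0r subr0.
      by rewrite -[X in X - _]mulr_natl subrr.
    have j0 : (0 < j)%N by apply: leq_ltn_trans nj.
    rewrite prednK // nth_default ?(leq_trans sH) //.
    by rewrite mul0rn mulr0 subr0 if_same.
  rewrite comp_polyB comp_polyZ dvdp_sub ?dvd_comp_lagXderiv //.
  by rewrite -mul_polyC dvdp_mull.
(* The coefficient of X^j is killed by j - n, which is nonzero in [F] for distinct j, n < p; only a
   monomial survives. *)
have HE : H = H`_n *: 'X^n.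
  apply/polyP => j; rewrite coefZ coefXn.
  case: eqP => [->|/eqP jn]; first by rewrite mulr1.
  rewrite mulr0; case: (ltnP j n) => nj; last first.
    by rewrite nth_default // (leq_trans sH) // ltn_neqAle eq_sym jn.
  have := congr1 (fun q : {poly F} => q`_j) H2.
  rewrite coef0 coefB coefZ coefXM coef_deriv.
  have -> : (if j == 0%N then 0 else H`_j.-1.+1 *+ j.-1.+1) = j%:R * H`_j.
    by case: (j) => [|i] /=; rewrite ?mul0r // mulr_natl.
  rewrite -mulrBl => /eqP; rewrite mulf_eq0 subr_eq0 natr_inj ?(negbTE jn) //; last lia.
  by move/eqP.
(* The power L^n has a nonzero representative of degree below p, so no nonzero multiple of it is
   divisible by [modp_a]. *)
have [Q [sQ Q0 dQ]] : exists Q : {poly F}, [/\ (size Q <= p)%N, Q != 0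
    & modp_a %| lag 1 ^+ n - Q].
  case: (posnP n) => [->|n0].
    by exists 1; rewrite size_poly1 oner_eq0 expr0 subrr dvdp0 prime_gt0.
  exists ((\prod_(1 <= s < n) bco s) *: lag n); split.
  - by rewrite (leq_trans (size_scale_leq _ _)) ?size_lag.
  - by rewrite scaler_eq0 negb_or prod_bco_neq0 // lag_neq0 ?n0.
  - by rewrite lag_exp ?n0.
move: dH; rewrite HE comp_polyZ comp_Xn_poly => dH.
have : H`_n *: Q = 0.
  apply: modp_a_dvd_small; first by rewrite (leq_trans (size_scale_leq _ _)).
  rewrite -(dvdp_addr _ (_ : modp_a %| H`_n *: (lag 1 ^+ n - Q))) -?scalerDr ?subrK //.
  by rewrite -mul_polyC dvdp_mull.
by move/eqP; rewrite scaler_eq0 (negbTE Q0) orbF => /eqP ->; rewrite scale0r.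
Qed.

(** * The compositional inverse of L *)

Definition Gp : {poly F} :=
  - \sum_(1 <= k < p) ((k%:R)^-1 / \prod_(1 <= s < k) bco s) *: 'X^k.

Lemma dvd_comp_Gp : modp_a %| (Gp \Po lag 1) - 'X.
Proof.
rewrite -[X in _ - X]sum_lag // /Gp raddfN /= raddf_sum /= -opprD dvdpNr.
rewrite -sumrB big_nat; apply: (big_ind (fun q => modp_a %| q)).
- exact: dvdp0.
- by move=> q r; apply: dvdp_add.
move=> k kp; have B0 := prod_bco_neq0 k ltac:(lia).
rewrite comp_polyZ comp_Xn_poly -mulrC -scalerA.
rewrite (_ : _ - _ = (k%:R^-1 / \prod_(1 <= s < k) bco s)
   *: (lag 1 ^+ k - (\prod_(1 <= s < k) bco s) *: lag k)).
  by rewrite -mul_polyC dvdp_mull ?lag_exp.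
by rewrite scalerBr !scalerA mulfVK // mulrC.
Qed.

Lemma comp_lag_uniq (G : {poly F}) :
  ((size G <= p)%N /\ modp_a %| (G \Po lag 1) - 'X) <-> G = Gp.
Proof.
have sG : (size Gp <= p)%N.
  apply/leq_sizeP => j pj; rewrite coefN coef_sum big_nat big1 ?oppr0 // => k kp.
  by rewrite coefZ coefXn gtn_eqF ?mulr0 //; lia.
split=> [[sG' dG]|->]; last by split; [|exact: dvd_comp_Gp].
apply/eqP; rewrite -subr_eq0; apply/eqP/comp_lag_inj.
  by rewrite (leq_trans (size_polyD _ _)) // geq_max sG' size_polyN.
by have := dvdp_sub dG dvd_comp_Gp; rewrite opprB addrA subrK comp_polyB.
Qed.

End PrimeCharacteristic.

Lemma laguerreE p : laguerre p = lag (Fpa p) p (alpha p) 1.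
Proof.
rewrite /laguerre /lag poly_def; apply: eq_bigr => k _.
by rewrite /lagc mul1r -[- 'X]scaleN1r exprZn scalerA.
Qed.

(** * Nonvanishing of b_{1,s} *)

Section ConstantTerm.
Variables (p : nat) (p_prime : prime p) (p_odd : odd p).

Let toFpa : {rmorphism 'F_p -> Fpa p} := @FracField.tofrac _ \o @polyC _.

Lemma pchar_Fpa : p \in [pchar Fpa p].
Proof. by rewrite (fmorph_pchar toFpa) pchar_Fp. Qed.

Lemma alpha_neq0 : alpha p != 0.
Proof. by rewrite tofrac_eq0 polyX_eq0. Qed.

(** The roles in [binomp] are exchanged here: the constant is the multiplier, and the polynomial
    variable is alpha. *)
Lemma binomf_tofrac (c : 'F_p) m :
  binomf (toFpa c * alpha p - 1) m = FracField.tofrac (binomp _ c m).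
Proof.
rewrite /binomp /binomf -mul_polyC rmorphM /= rmorph_prod mulrC.
congr (_ * _); first by rewrite -[RHS]/(toFpa _) fmorphV rmorph_nat.
apply: eq_bigr => i _.
rewrite -mul_polyC rmorphB rmorphM polyCD polyC_natr rmorphD rmorph1 rmorph_nat.
by rewrite opprD addrA.
Qed.

Lemma bcoef1_neq0 s : (1 <= s < p.-1)%N -> bcoef p 1 s != 0.
Proof.
move=> sp; pose x : 'F_p := - 1%:R / s%:R.
pose q : {poly 'F_p} :=
  \sum_(k < p) (x ^+ k)%:P * binomp _ 1%:R (p.-1 - k) * binomp _ s%:R k.
have -> : bcoef p 1 s = FracField.tofrac q.
  rewrite /q rmorph_sum; apply: eq_bigr => k _.
  rewrite !rmorphM /= -!binomf_tofrac !rmorph_nat; congr (_ * _ * _).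
  rewrite -[RHS]/(toFpa _) rmorphXn; congr (_ ^+ _).
  by rewrite /x rmorphM fmorphV rmorphN !rmorph_nat.
rewrite tofrac_eq0; apply/eqP => /(congr1 (horner^~ 0)) /eqP.
have charp := pchar_Fp p_prime; have p1 := prime_gt1 p_prime.
rewrite /q horner_sum horner0 (eq_bigr (fun k : 'I_p => x ^+ k)) => [S0|k _].
  (* A vanishing geometric sum gives x^p = 1. As x^p = x in the prime field, x = 1, so s+1 = 0,
     impossible for 0 < s+1 < p. *)
  have : x ^+ p - 1 = 0 by rewrite subrX1 (eqP S0) mulr0.
  rewrite -[x in x ^+ _]natr_Zp natr_expp // natr_Zp => /subr0_eq x1.
  have s0 : s%:R != 0 :> 'F_p by apply: (natr_neq0 _ p) => //; lia.
  have /eqP[] : s.+1%:R != 0 :> 'F_p by apply: (natr_neq0 _ p) => //; lia.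
  have : x * s%:R = - 1 by rewrite /x divfK.
  by rewrite x1 mul1r -natr1 => ->; rewrite addNr.
rewrite !hornerM hornerC !binompE !mul0r sub0r.
have kp := ltn_ord k.
rewrite !(binomfN1 _ p) //; last lia.
rewrite -mulrA -exprD subnK; last by lia.
have e : odd p.-1 = false by lia.
by rewrite -signr_odd e mulr1.
Qed.

End ConstantTerm.

(** The first conjunct ensures that the denominators in [Gpoly p] are genuine, since inversion of 0
    is by convention 0; indices up to p-2 are all that occur there. *)
Theorem theorem2 (p : nat) (p_prime : prime p) (p_odd : odd p) :
  (forall s : nat, (1 <= s < p.-1)%N -> bcoef p 1 s != 0) /\
  (forall G : {poly Fpa p},
     ((size G <= p)%N /\ modulus p %| (G \Po laguerre p) - 'X) <-> G = Gpoly p).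
Proof.
split=> [s|G]; first exact: bcoef1_neq0.
rewrite laguerreE; apply: comp_lag_uniq => //.
- exact: pchar_Fpa.
- exact: alpha_neq0.
- by move=> s; apply: bcoef1_neq0.
Qed.
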